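(* Suppose that the Jacobi endomorphism $\Phi$ of a spray $S$ is diagonalizable, and consider a projective change $\tilde S:=S-2P\Delta$. Then $\tilde\Phi$ is diagonalizable if and only if one of the following conditions is satisfied: (1) $a\neq-\lambda_j$ for any $j$ in $2,\ldots,n$; (2) $a=-\lambda_j$ for some $j$ in $2,\ldots,n$ and $b(X)=0$ for all $X\in D_{\lambda_j}$. In each of these cases: (1) if $\lambda$ is an eigenfunction of $\Phi$, then $\tilde\lambda:=\lambda+a$ is an eigenfunction of $\tilde\Phi$; (2) if $X\in D_\lambda$, then $\tilde X:=(\lambda+a)X+b(X)\mathbf T\in\tilde D_{\tilde\lambda}$.
   Context: $M$ is a smooth $n$-dimensional manifold, $\tau:TM\to M$ its tangent bundle, with natural coordinates $(x^i,\dot x^i)$; homogeneous objects are considered away from the zero section. A vector field along $\tau$ is $X=X^i(x,\dot x)\frac{\partial}{\partial x^i}$; $\mathbf T=\dot x^i\frac{\partial}{\partial x^i}$. A spray is a vector field $S=\dot x^i\frac{\partial}{\partial x^i}+f^i(x,\dot x)\frac{\partial}{\partial\dot x^i}$ with $[\Delta,S]=S$, where $\Delta=\dot x^i\frac{\partial}{\partial\dot x^i}$ is the Liouville vector field. Put $\Gamma^i_j=-\frac12\frac{\partial f^i}{\partial\dot x^j}$, $X^V=X^i\frac{\partial}{\partial\dot x^i}$ and $X^H=X^i\big(\frac{\partial}{\partial x^i}-\Gamma^j_i\frac{\partial}{\partial\dot x^j}\big)$. The Jacobi endomorphism $\Phi$ of $S$ is the type (1,1) tensor field along $\tau$ with components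 $\Phi^i_j=-\frac{\partial f^i}{\partial x^j}-\Gamma^k_j\Gamma^i_k-S(\Gamma^i_j)$. For a spray $\Phi(\mathbf T)=0$, so $\mathbf T$ is always an eigenvector with eigenvalue $0$; the other eigenfunctions of $\Phi$ are denoted $\lambda_2,\ldots,\lambda_n$, where some of them may be equal and some of them may be zero. $D_\lambda$ denotes the eigendistribution of $\Phi$ corresponding to an eigenfunction $\lambda$, i.e. the vector fields $X$ along $\tau$ with $\Phi(X)=\lambda X$. A projective change of $S$ is $\tilde S=S-2P\Delta$ with $P$ a positively 1-homogeneous function ($P(\mu v)=\mu P(v)$ for $\mu>0$). $\tilde\Phi$ and $\tilde D_{\tilde\lambda}$ are the corresponding Jacobi endomorphism and eigendistribution for $\tilde S$. One has $\tilde\Phi(X)=\Phi(X)+aX+b(X)\mathbf T$, with $a=P^2-S(P)$ and $b$ the one-form along $\tau$ given by $b(X)=3X^H(P)-P\,X^V(P)-X^V(S(P))$; in particular $b(\mathbf T)=-a$.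
   Formalization: Conclusion (1) is stated for λ among λ_2,…,λ_n only, since it fails for the eigenfunction 0 when that belongs to T alone; diagonalizability, eigenfunctions, D_λ and conditions (1), (2) are read at each point. *)

(* Defs.v *)
From HB Require Import structures.
From mathcomp Require Import all_boot all_order all_algebra.
From mathcomp Require Import all_classical all_reals all_analysis.
Set Implicit Arguments.
Unset Strict Implicit.
Unset Printing Implicit Defensive.
Import Order.TTheory GRing.Theory Num.Theory.
Import numFieldNormedType.Exports.
Local Open Scope classical_set_scope.
Local Open Scope ring_scope.

(* C^oo maps, on an open set [A]: all iterated directional derivatives are
   (Frechet) differentiable at the points of [A]. *)
Definition iter_derive (R : realType) (V W : normedModType R)
    (vs : seq V) (f : V -> W) : V -> W :=
  foldr (fun v (g : V -> W) => fun x => 'D_v g x) f vs.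

Definition smooth_on (R : realType) (V W : normedModType R)
    (A : set V) (f : V -> W) :=
  forall (vs : seq V) (x : V), A x -> differentiable (iter_derive vs f) x.

(* A smooth n-dimensional manifold with a chosen atlas.  [param c] is the
   inverse of [chart c]; only its values on [chart c @` dom c] matter. *)
Record manifold (R : realType) (n : nat) := Manifold {
  pt :> topologicalType ;
  _ : hausdorff_space pt ;
  _ : @second_countable pt ;
  chart_idx : Type ;
  dom : chart_idx -> set pt ;
  chart : chart_idx -> pt -> 'rV[R]_n ;
  param : chart_idx -> 'rV[R]_n -> pt ;
  chart_cover : forall p, exists c, dom c p ;
  dom_open : forall c, open (dom c) ;
  cod_open : forall c, open (chart c @` dom c) ;
  chartK : forall c p, dom c p -> param c (chart c p) = p ;
  chart_continuous : forall c p, dom c p -> {for p, continuous (chart c)} ;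
  param_continuous :
    forall c x, (chart c @` dom c) x -> {for x, continuous (param c)} ;
  chart_smooth : forall c d,
    smooth_on (chart c @` (dom c `&` dom d)) (chart d \o param c)
}.

Notation coord_TM R n := ('rV[R]_n * 'rV[R]_n)%type.

Definition cod (R : realType) (n : nat) (M : manifold R n)
    (c : chart_idx M) : set 'rV[R]_n := chart c @` dom c.

Definition transition (R : realType) (n : nat) (M : manifold R n)
    (c d : chart_idx M) : 'rV[R]_n -> 'rV[R]_n := chart d \o param c.

(* A tangent vector is its foot together with its components in every chart
   around the foot; the components in the other charts are set to 0, so that a
   tangent vector is determined by its foot and its components in one chart. *)
Record tangent (R : realType) (n : nat) (M : manifold R n) := Tangent {
  foot : M ;
  tcomp : chart_idx M -> 'rV[R]_n ;
  tcomp_law : forall c d, dom c foot -> dom d foot ->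
    tcomp d = 'D_(tcomp c) (transition c d) (chart c foot) ;
  tcomp_out : forall c, ~ dom c foot -> tcomp c = 0
}.

Definition slit (R : realType) (n : nat) (M : manifold R n)
  : set (tangent M) :=
  [set v | forall c, dom c (foot v) -> tcomp v c != 0].
Arguments slit {R n} M.

(* The natural coordinates (x, xdot) of a tangent vector. *)
Definition coords (R : realType) (n : nat) (M : manifold R n)
    (c : chart_idx M) (v : tangent M) : coord_TM R n :=
  (chart c (foot v), tcomp v c).

Definition slit_coords (R : realType) (n : nat) (M : manifold R n)
    (c : chart_idx M) : set (coord_TM R n) :=
  [set z | cod c z.1 /\ z.2 != 0].

Lemma transition_differentiable (R : realType) (n : nat) (M : manifold R n)
    (c d : chart_idx M) (p : M) :
  dom c p -> dom d p -> differentiable (transition c d) (chart c p).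
Proof. move=> cp dp; apply: (@chart_smooth _ _ M c d [::]).
by exists p. Qed.

Lemma transition_near (R : realType) (n : nat) (M : manifold R n)
    (c d : chart_idx M) (p : M) : dom c p -> dom d p ->
  \forall x \near chart c p, cod c x /\ dom d (param c x).
Proof.
move=> cp dp; have cx : cod c (chart c p) by exists p.
apply: filterI.
  by apply: open_nbhs_nbhs; split => //; exact: cod_open.
apply: (param_continuous cx); rewrite chartK //.
by apply: open_nbhs_nbhs; split => //; exact: dom_open.
Qed.

Lemma transition_chain (R : realType) (n : nat) (M : manifold R n)
    (c d e : chart_idx M) (p : M) (y : 'rV[R]_n) :
  dom c p -> dom d p -> dom e p ->
  'D_y (transition c e) (chart c p) =
  'D_('D_y (transition c d) (chart c p)) (transition d e) (chart d p).
Proof.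
move=> cp dp ep.
have cdp : transition c d (chart c p) = chart d p.
  by rewrite /transition /= chartK.
have df1 := transition_differentiable cp dp.
have df2 := transition_differentiable dp ep.
transitivity ('D_y (transition d e \o transition c d) (chart c p)).
  apply: near_eq_derive; apply: filterS (transition_near cp dp) => x [_ dx].
  by rewrite /transition /= chartK.
rewrite deriveE; last by apply: differentiable_comp => //; rewrite cdp.
by rewrite diff_comp ?cdp //= -!deriveE.
Qed.

(* The tangent vector with natural coordinates [z] in the chart [c]; it is the
   zero vector (a junk value) when [z.1] is not in the range of the chart. *)
Definition tangent_at_comp (R : realType) (n : nat) (M : manifold R n)
    (c : chart_idx M) (z : coord_TM R n) (d : chart_idx M) : 'rV[R]_n :=
  if `[< cod c z.1 /\ dom d (param c z.1) >]
  then 'D_(z.2) (transition c d) z.1 else 0.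

Fact tangent_at_law (R : realType) (n : nat) (M : manifold R n)
    (c : chart_idx M) (z : coord_TM R n) (d e : chart_idx M) :
  dom d (param c z.1) -> dom e (param c z.1) ->
  tangent_at_comp c z e =
  'D_(tangent_at_comp c z d) (transition d e) (chart d (param c z.1)).
Proof.
move=> dp ep; rewrite /tangent_at_comp; have [[p cp pz]|ncz] := pselect (cod c z.1).
  have cz : cod c z.1 by exists p.
  do 2 (rewrite asboolT; last by split).
  move: dp ep; rewrite -pz chartK // => dp ep.
  exact: transition_chain.
rewrite asboolF; last by case.
rewrite asboolF; last by case.
by rewrite deriveE ?linear0 //; exact: transition_differentiable.
Qed.

Fact tangent_at_out (R : realType) (n : nat) (M : manifold R n)
    (c : chart_idx M) (z : coord_TM R n) (d : chart_idx M) :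
  ~ dom d (param c z.1) -> tangent_at_comp c z d = 0.
Proof. by move=> nd; rewrite /tangent_at_comp asboolF // => -[]. Qed.

Definition tangent_at (R : realType) (n : nat) (M : manifold R n)
    (c : chart_idx M) (z : coord_TM R n) : tangent M :=
  Tangent (@tangent_at_law R n M c z) (@tangent_at_out R n M c z).

Lemma transition_id (R : realType) (n : nat) (M : manifold R n) (c : chart_idx M) (p : M)
    (y : 'rV[R]_n) :
  dom c p -> 'D_y (transition c c) (chart c p) = y.
Proof.
move=> cp.
transitivity ('D_y (@id 'rV[R]_n) (chart c p)); last by rewrite derive_id.
apply: near_eq_derive. apply: filterS (transition_near cp cp) => x [[q cq <-] _].
by rewrite /transition /= chartK.
Qed.
Lemma tangent_atK (R : realType) (n : nat) (M : manifold R n) (c : chart_idx M)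
    (z : coord_TM R n) :
  cod c z.1 -> coords c (tangent_at c z) = z.
Proof.
case: z => x y /= [p cp px]. rewrite -px /coords /= /tangent_at_comp /= chartK //.
rewrite asboolT; last by split => //; exists p.
by rewrite transition_id.
Qed.
Lemma coordsK (R : realType) (n : nat) (M : manifold R n) (c : chart_idx M) (v : tangent M) :
  dom c (foot v) -> tangent_at c (coords c v) = v.
Proof.
move=> cv.
have e1 : foot (tangent_at c (coords c v)) = foot v by rewrite /= chartK.
have e2 : tcomp (tangent_at c (coords c v)) = tcomp v.
  apply/funext => d; rewrite /= /tangent_at_comp /= chartK //.
  have [dv|nd] := pselect (dom d (foot v)).
    rewrite asboolT; last by split => //; exists (foot v).
    by rewrite -tcomp_law.
  by rewrite asboolF ?tcomp_out // => -[].
move: e1 e2; case: (tangent_at _ _) => p f l1 o1; case: v {cv} => q g l2 o2 /= e1 e2.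
subst q; subst g; congr Tangent; exact: Prop_irrelevance.
Qed.

Fact scale_law (R : realType) (n : nat) (M : manifold R n)
    (mu : R) (v : tangent M) (c d : chart_idx M) :
  dom c (foot v) -> dom d (foot v) ->
  mu *: tcomp v d = 'D_(mu *: tcomp v c) (transition c d) (chart c (foot v)).
Proof.
move=> cv dv; rewrite (tcomp_law cv dv).
by rewrite !deriveE ?linearZ //; exact: transition_differentiable.
Qed.

Fact scale_out (R : realType) (n : nat) (M : manifold R n)
    (mu : R) (v : tangent M) (c : chart_idx M) :
  ~ dom c (foot v) -> mu *: tcomp v c = 0.
Proof. by move=> /tcomp_out ->; rewrite scaler0. Qed.

Definition tangent_scale (R : realType) (n : nat) (M : manifold R n)
    (mu : R) (v : tangent M) : tangent M :=
  Tangent (@scale_law R n M mu v) (@scale_out R n M mu v).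

(* Coordinate expression of a function on TM. *)
Definition local (R : realType) (n : nat) (M : manifold R n)
    (F : tangent M -> R) (c : chart_idx M) : coord_TM R n -> R :=
  fun z => F (tangent_at c z).

(* Only the values off the zero section are constrained. *)
Definition smooth_function (R : realType) (n : nat) (M : manifold R n)
    (F : tangent M -> R) :=
  forall c, smooth_on (slit_coords c) (local F c).

Definition pos_homogeneous (R : realType) (n : nat) (M : manifold R n)
    (F : tangent M -> R) :=
  forall (v : tangent M) (mu : R), slit M v -> 0 < mu ->
    F (tangent_scale mu v) = mu * F v.

Definition tangent_transition (R : realType) (n : nat) (M : manifold R n)
    (c d : chart_idx M) (z : coord_TM R n) : coord_TM R n :=
  (transition c d z.1, 'D_(z.2) (transition c d) z.1).

(* Vector fields on the slit tangent bundle, given by their components with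
   respect to the natural coordinates of each chart: [(X c z).1] collects the
   coefficients of the d/dx^i and [(X c z).2] those of the d/dxdot^i. *)
Definition vfield (R : realType) (n : nat) (M : manifold R n) :=
  chart_idx M -> coord_TM R n -> coord_TM R n.

Definition is_vfield (R : realType) (n : nat) (M : manifold R n)
    (X : vfield M) :=
  (forall c, smooth_on (slit_coords c) (X c)) /\
  (forall c d z, slit_coords c z -> dom d (param c z.1) ->
     X d (tangent_transition c d z) = 'D_(X c z) (tangent_transition c d) z).

Definition lie_bracket (R : realType) (n : nat) (M : manifold R n)
    (X Y : vfield M) : vfield M :=
  fun c z => 'D_(X c z) (Y c) z - 'D_(Y c z) (X c) z.

Definition liouville (R : realType) (n : nat) (M : manifold R n) : vfield M :=
  fun c z => (0, z.2).
Arguments liouville {R n} M.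

Definition is_spray (R : realType) (n : nat) (M : manifold R n)
    (S : vfield M) :=
  [/\ is_vfield S,
      forall c z, slit_coords c z -> (S c z).1 = z.2 &
      forall c z, slit_coords c z ->
        lie_bracket (liouville M) S c z = S c z].

Definition projective_change (R : realType) (n : nat) (M : manifold R n)
    (S : vfield M) (P : tangent M -> R) : vfield M :=
  fun c z => S c z - (2 * local P c z) *: liouville M c z.

Definition ddx (R : realType) (n : nat) (j : 'I_n) : coord_TM R n :=
  (delta_mx 0 j, 0).
Definition ddxdot (R : realType) (n : nat) (j : 'I_n) : coord_TM R n :=
  (0, delta_mx 0 j).

Definition force (R : realType) (n : nat) (M : manifold R n)
    (S : vfield M) (c : chart_idx M) (i : 'I_n) : coord_TM R n -> R :=
  fun z => (S c z).2 0 i.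

(* [Gamma S c i j] is Gamma^i_j. *)
Definition Gamma (R : realType) (n : nat) (M : manifold R n)
    (S : vfield M) (c : chart_idx M) (i j : 'I_n) : coord_TM R n -> R :=
  fun z => - (1 / 2) * 'D_(ddxdot R j) (force S c i) z.

(* Components Phi^i_j of the Jacobi endomorphism. *)
Definition jacobi_comp (R : realType) (n : nat) (M : manifold R n)
    (S : vfield M) (c : chart_idx M) (z : coord_TM R n) (i j : 'I_n) : R :=
  - 'D_(ddx R j) (force S c i) z
  - \sum_(k < n) Gamma S c k j z * Gamma S c i k z
  - 'D_(S c z) (Gamma S c i j) z.

(* Elements X = X^i d/dx^i of the fibre are row vectors, acted upon from the
   right: Phi(X) = X *m jacobi, whence the index placement. *)
Definition jacobi (R : realType) (n : nat) (M : manifold R n)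
    (S : vfield M) (c : chart_idx M) (z : coord_TM R n) : 'M[R]_n :=
  \matrix_(j < n, i < n) jacobi_comp S c z i j.

Definition eigendist (R : realType) (n : nat) (M : manifold R n)
    (S : vfield M) (c : chart_idx M) (z : coord_TM R n) (l : R)
  : set 'rV[R]_n := [set X | X *m jacobi S c z = l *: X].

Definition vlift (R : realType) (n : nat) (X : 'rV[R]_n) : coord_TM R n :=
  (0, X).

Definition hlift (R : realType) (n : nat) (M : manifold R n)
    (S : vfield M) (c : chart_idx M) (z : coord_TM R n) (X : 'rV[R]_n)
  : coord_TM R n :=
  (X, - \row_(j < n) \sum_(i < n) X 0 i * Gamma S c j i z).

Definition Tfield (R : realType) (n : nat) (z : coord_TM R n) : 'rV[R]_n := z.2.

Definition S_of_P (R : realType) (n : nat) (M : manifold R n)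
    (S : vfield M) (P : tangent M -> R) (c : chart_idx M)
  : coord_TM R n -> R := fun z => 'D_(S c z) (local P c) z.

Definition proj_a (R : realType) (n : nat) (M : manifold R n)
    (S : vfield M) (P : tangent M -> R) (c : chart_idx M)
    (z : coord_TM R n) : R := local P c z ^+ 2 - S_of_P S P c z.

Definition proj_b (R : realType) (n : nat) (M : manifold R n)
    (S : vfield M) (P : tangent M -> R) (c : chart_idx M)
    (z : coord_TM R n) (X : 'rV[R]_n) : R :=
  3 * 'D_(hlift S c z X) (local P c) z
  - local P c z * 'D_(vlift X) (local P c) z
  - 'D_(vlift X) (S_of_P S P c) z.

(* Main.v *)
Require Import Defs.
From HB Require Import structures.
From mathcomp Require Import all_boot all_order all_algebra.
From mathcomp Require Import all_classical all_reals all_analysis.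
From mathcomp Require Import ring lra.
Set Implicit Arguments.
Unset Strict Implicit.
Unset Printing Implicit Defensive.
Import Order.TTheory GRing.Theory Num.Theory.
Import numFieldNormedType.Exports.
Local Open Scope classical_set_scope.
Local Open Scope ring_scope.

(* In a chart every force component f^i is 2-homogeneous and P is 1-homogeneous
   in xdot, so Euler's relations, also for the derivatives of f^i and P,
   together with the symmetry of second derivatives give
   Phi~ = Phi + a + b (x) T, with Phi(T) = 0 and b(T) = - a.  The rest is linear
   algebra at a single point.  T lies in the kernel of Phi~, and
   Phi(X) = lambda X makes (lambda + a) X + b(X) T an eigenvector of Phi~; with T
   these vectors recover X as soon as lambda + a <> 0.  On an eigenspace with
   lambda + a = 0, Phi~ is X |-> b(X) T, whose square is 0, so diagonalizability of Phi~ amounts to b = 0 there.  The case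
   lambda = 0 uses that a diagonalizable Phi has as many independent kernel
   vectors as its characteristic polynomial has factors 'X. *)

(** * Rank-one shifts of diagonalizable matrices *)

Lemma root_prod_XsubCP (F : fieldType) (I : finType) (p : pred I) (f : I -> F)
    (x : F) :
  reflect (exists2 i, p i & f i = x) (root (\prod_(i | p i) ('X - (f i)%:P)) x).
Proof.
rewrite rootE horner_prod; apply: (iffP (prodf_eq0 _ _)) => -[i pi fi];
  exists i => //.
  by move: fi; rewrite hornerXsubC subr_eq0 eq_sym => /eqP.
by rewrite hornerXsubC fi subrr.
Qed.

(** Similar matrices have the same characteristic polynomial. The form [Q *m A = diag_mx d *m Q]
    makes every row of [Q] an eigenvector of [A] acting from the right. *)
Lemma diagonalizable_rows (F : fieldType) (n : nat) (A : 'M[F]_n) :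
  diagonalizable A ->
  exists (Q : 'M[F]_n) (d : 'rV[F]_n),
    [/\ Q \in unitmx, Q *m A = diag_mx d *m Q &
        char_poly A = \prod_i ('X - (d 0 i)%:P)].
Proof.
move=> [Q uQ /diagonalizable_forPex[d /(simmxP uQ) QA]].
exists Q, d; split => //.
have uQ' : \det (map_mx (@polyC F) Q) != 0.
  by rewrite det_map_mx polyC_eq0 -unitfE -unitmxE.
(* Both sides are multiplied by the nonzero constant polynomial det Q, and Q ('X - A) = ('X - d) Q
   is used under the determinant. *)
apply: (mulfI uQ'); rewrite /char_poly -det_mulmx /char_poly_mx mulmxBr.
rewrite -map_mxM /= QA map_mxM /= scalar_mxC -mulmxBl det_mulmx mulrC.
congr (_ * _).
rewrite -/(char_poly_mx _) -/(char_poly _) char_poly_trig ?diag_mx_is_trig //.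
by apply: eq_bigr => i _; rewrite mxE eqxx.
Qed.

(** In an eigenbasis [A] multiplies the k-th coordinate c of [X] by the entry d of [d], and c d^2 =
    0 forces c d = 0 in a field. *)
Lemma diagonalizable_sq0 (F : fieldType) (n : nat) (A : 'M[F]_n)
    (X : 'rV[F]_n) :
  diagonalizable A -> X *m A *m A = 0 -> X *m A = 0.
Proof.
move=> /diagonalizable_rows[Q [d [uQ QA _]]] XAA.
have AQ : A *m invmx Q = invmx Q *m diag_mx d.
  by rewrite -[LHS](mulKmx uQ) (mulmxA Q) QA mulmxK.
have : X *m invmx Q *m diag_mx d *m diag_mx d = 0.
  rewrite -2!mulmxA (mulmxA (invmx Q)) -AQ -(mulmxA A) -AQ.
  by rewrite !mulmxA XAA mul0mx.
rewrite -(mulmxKV uQ (X *m A)) -(mulmxA X A) AQ mulmxA => cDD.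
rewrite (_ : _ *m diag_mx d = 0) ?mul0mx //; apply/rowP => k.
move/rowP: cDD => /(_ k); rewrite !mul_mx_diag !mxE => /eqP.
by rewrite mulf_eq0 => /orP[/eqP//|/eqP->]; rewrite mulr0.
Qed.

Section RankOneShift.
Variables (F : fieldType) (n m : nat) (A : 'M[F]_n) (T : 'rV[F]_n).
Variables (beta : 'cV[F]_n) (a : F) (l : 'I_m -> F).
Hypotheses (dA : diagonalizable A) (T0 : T != 0) (TA : T *m A = 0).
Hypothesis Tb : T *m beta = - a%:M.
Hypothesis cA : char_poly A = 'X * \prod_j ('X - (l j)%:P).

(** [A] stands for Phi at a point, [T] for the field T there and [beta] for the column of the
    one-form b, so [X *m beta] is b(X) and [B] is Phi~. *)
Local Notation B := (A + a%:M + beta *m T).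

Lemma mulmx_shift (X : 'rV[F]_n) :
  X *m B = X *m A + a *: X + (X *m beta) 0 0 *: T.
Proof.
rewrite !mulmxDr mul_mx_scalar mulmxA {1}[X *m beta]mx11_scalar.
by rewrite mul_scalar_mx.
Qed.

(** The shift contributes a T and the rank-one term b(T) T = - a T; they cancel. *)
Lemma shift_kernel : T *m B = 0.
Proof. by rewrite mulmx_shift TA Tb !mxE mulr1n add0r scaleNr subrr. Qed.

(** [Y] is nothing but [X *m B]. Applying [B] once more multiplies it by r + a, because the
    component along [T] is killed. *)
Lemma shift_eigenvector (r : F) (X : 'rV[F]_n) : X *m A = r *: X ->
  let Y := (r + a) *: X + (X *m beta) 0 0 *: T in Y *m B = (r + a) *: Y.
Proof.
move=> XA Y; rewrite /Y mulmxDl -!scalemxAl shift_kernel scaler0 addr0.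
by rewrite mulmx_shift XA -scalerDl.
Qed.

(** The factor 'X makes some diagonal entry d_i zero. Cancelling it leaves two equal products of
    linear factors, so the [l j] and the entries other than d_i take the same values. One kernel row
    is thus set apart from the rows carrying the [l j], even if some [l j] is zero. *)
Lemma diagonal_rows_kernel :
  exists (Q : 'M[F]_n) (d : 'rV[F]_n) (i : 'I_n),
    [/\ Q \in unitmx, Q *m A = diag_mx d *m Q, d 0 i = 0 &
        forall x, (exists j, l j = x) <-> (exists2 k, k != i & d 0 k = x)].
Proof.
have [Q [d [uQ QA cd]]] := diagonalizable_rows dA.
have X0 : ('X : {poly F}) != 0 by rewrite polyX_eq0.
have : root (char_poly A) 0 by rewrite cA rootM rootX eqxx.
rewrite cd => /root_prod_XsubCP[i _ di].
have E : \prod_(k | k != i) ('X - (d 0 k)%:P) = \prod_j ('X - (l j)%:P).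
  by apply: (mulfI X0); rewrite -cA cd [in RHS](bigD1 i) //= di subr0.
exists Q, d, i; split=> // x; split=> [[j lj]|[k ki dk]].
  have : root (\prod_j ('X - (l j)%:P)) x by apply/root_prod_XsubCP; exists j.
  by rewrite -E => /root_prod_XsubCP.
have : root (\prod_(k | k != i) ('X - (d 0 k)%:P)) x.
  by apply/root_prod_XsubCP; exists k.
by rewrite E => /root_prod_XsubCP[j]; exists j.
Qed.

(** A row of [Q] with eigenvalue [l j], other than row i, will do unless it lies on the line of [T].
    In that case [l j] is zero, and row i serves: it is a kernel vector too, and two independent
    rows cannot both be multiples of [T]. *)
Lemma eigenvector_outside_line (j : 'I_m) :
  exists2 X : 'rV[F]_n, X *m A = l j *: X & ~~ (X <= T)%MS.
Proof.
have [Q [d [i [uQ QA di ld]]]] := diagonal_rows_kernel.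
have [k ki dk] := (ld (l j)).1 (ex_intro _ j erefl).
have rA k' : row k' Q *m A = d 0 k' *: row k' Q.
  by rewrite -row_mul QA row_mul row_diag_mx -scalemxAl -rowE.
(* Independence of the rows, in coordinates: if x T is row k' of [Q], then x times the coordinate
   vector of [T] is the k'-th unit vector. *)
have coord x k' : row k' Q = x *: T ->
    forall k'', x * (T *m invmx Q) 0 k'' = (k' == k'')%:R.
  move=> rT k''; transitivity ((x *: (T *m invmx Q)) 0 k'').
    by rewrite [RHS]mxE.
  by rewrite scalemxAl -rT -row_mul mulmxV // !mxE.
case: (boolP (row k Q <= T)%MS) => [|nkT]; last first.
  by exists (row k Q) => //; rewrite rA dk.
case/sub_rVP => y rkT.
have l0 : l j = 0.
  have /eqP : l j *: row k Q = 0 by rewrite -dk -rA rkT -scalemxAl TA scaler0.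
  rewrite scaler_eq0 => /orP[/eqP//|/eqP rk0].
  have := coord 0 k; rewrite scale0r => /(_ rk0 k)/eqP.
  by rewrite mul0r eqxx eq_sym oner_eq0.
exists (row i Q); first by rewrite rA di l0.
apply/sub_rVP => -[x riT].
(* With u the coordinates of [T], x u_k = 0. But x = 0 contradicts x u_i = 1, and u_k = 0
   contradicts y u_k = 1. *)
have := coord _ _ riT k; rewrite [i == k]eq_sym (negPf ki) => /eqP.
rewrite mulf_eq0 => /orP[]/eqP u0.
  by have /eqP := coord _ _ riT i; rewrite u0 mul0r eqxx eq_sym oner_eq0.
by have /eqP := coord _ _ rkT k; rewrite u0 mulr0 eqxx eq_sym oner_eq0.
Qed.

(** Now d_i is the only zero diagonal entry, so the kernel is spanned by row i of [Q]; it contains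
    the nonzero vector [T], which therefore spans it as well. *)
Lemma kernel_line (X : 'rV[F]_n) :
  (forall j, l j != 0) -> X *m A = 0 -> (X <= T)%MS.
Proof.
move=> l0; have [Q [d [i [uQ QA di ld]]]] := diagonal_rows_kernel.
have dk k : k != i -> d 0 k != 0.
  move=> ki; have [|j <-//] := (ld (d 0 k)).2; by exists k.
have ker (Y : 'rV[F]_n) : Y *m A = 0 -> exists k, Y = k *: row i Q.
  move=> YA; pose c := Y *m invmx Q.
  have cD : c *m diag_mx d = 0.
    have : (c *m diag_mx d) *m Q = 0 by rewrite -mulmxA -QA mulmxA mulmxKV.
    by move/(congr1 (mulmx^~ (invmx Q))); rewrite mulmxK // mul0mx.
  exists (c 0 i); rewrite -(mulmxKV uQ Y) -/c rowE scalemxAl; congr (_ *m _).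
  apply/rowP => k; rewrite !mxE eqxx /=; case: eqVneq => [->|ki].
    by rewrite mulr1.
  rewrite mulr0; have /rowP/(_ k) := cD.
  rewrite mul_mx_diag !mxE => /eqP; rewrite mulf_eq0 (negPf (dk _ ki)) orbF.
  by move/eqP.
have [t Tt] := ker _ TA; move=> /ker[x ->].
have t0 : t != 0 by apply: contra_neq T0 => t0; rewrite Tt t0 scale0r.
by apply/sub_rVP; exists (x / t); rewrite Tt scalerA divfK.
Qed.

(** If l_j + a = 0 the eigenvector is [T] itself. Otherwise [shift_eigenvector] is applied to an [X]
    off the line of [T], which keeps the result nonzero. *)
Lemma shift_eigenvalue (j : 'I_m) : eigenvalue B (l j + a).
Proof.
have [la0|la0] := eqVneq (l j + a) 0.
  by apply/eigenvalueP; exists T => //; rewrite shift_kernel la0 scale0r.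
have [X XA nXT] := eigenvector_outside_line j.
apply/eigenvalueP; eexists; first exact: shift_eigenvector XA.
apply: contra nXT => /eqP/(canRL (addrK _)); rewrite sub0r -scaleNr.
move=> /(canRL (scalerK la0)) ->; rewrite scalerA; exact: scalemx_sub.
Qed.

(** The eigenspaces of [B] span, since their sum contains [T] and every row of [Q]: a row with d_k +
    a nonzero is recovered from its shifted eigenvector and [T]; any other row is either a multiple
    of [T] or in the kernel of [B]. *)
Lemma shift_diagonalizable :
  (forall r (X : 'rV[F]_n), r + a = 0 -> X *m A = r *: X ->
     (X <= T)%MS \/ X *m beta = 0) -> diagonalizable B.
Proof.
move=> H; have [Q [d [uQ QA _]]] := diagonalizable_rows dA.
apply/diagonalizablePeigen.
(* The value 0 is added for the eigenvector [T]. *)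
pose rs := undup (0 :: [seq d 0 i + a | i : 'I_n]).
exists rs; first exact: undup_uniq.
apply/eqmxP; rewrite submx1 /= -[X in (X <= _)%MS](mulVmx uQ).
apply: mulmx_sub; apply/row_subP => k.
have rA : row k Q *m A = d 0 k *: row k Q.
  by rewrite -row_mul QA row_mul row_diag_mx -scalemxAl -rowE.
have sub r : r \in rs -> (eigenspace B r <= \sum_(r <- rs) eigenspace B r)%MS.
  by move=> rr; rewrite (bigD1_seq r) ?undup_uniq //= addsmxSl.
have T_in : (T <= \sum_(r <- rs) eigenspace B r)%MS.
  apply: submx_trans (sub 0 _); last by rewrite mem_undup mem_head.
  by apply/eigenspaceP; rewrite shift_kernel scale0r.
have [da|da] := eqVneq (d 0 k + a) 0.
  have [XT|Xb] := H _ _ da rA; first exact: submx_trans XT T_in.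
  apply: submx_trans (sub 0 _); last by rewrite mem_undup mem_head.
  apply/eigenspaceP.
  by rewrite mulmx_shift rA -scalerDl da Xb mxE !scale0r addr0.
have := shift_eigenvector rA => /= YB.
rewrite -[row k Q](scalerK da); apply: scalemx_sub.
set Y := (X in X *m _ = _) in YB.
rewrite -[_ *: row k Q](addrK ((row k Q *m beta) 0 0 *: T)).
apply: addmx_sub; last by rewrite -scaleNr scalemx_sub.
apply: submx_trans (sub (d 0 k + a) _); first exact/eigenspaceP.
by rewrite mem_undup inE fintype.image_f ?orbT.
Qed.

Lemma shift_diagonalizable_iff :
  diagonalizable B <->
    (forall j, a <> - l j) \/
    (exists j, a = - l j /\
       forall X : 'rV[F]_n, X *m A = l j *: X -> (X *m beta) 0 0 = 0).
Proof.
have b0 (X : 'rV[F]_n) : (X *m beta) 0 0 = 0 -> X *m beta = 0.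
  by move=> Xb; rewrite [LHS]mx11_scalar Xb raddf0.
split=> [dB|[al|[j [aj bj]]]].
- have [|] := boolP [exists j, a == - l j]; last first.
    by rewrite negb_exists => /forallP al; left => j; apply/eqP.
  move=> /existsP[j /eqP aj]; right; exists j; split => // X XA.
  (* On this eigenspace [B] sends X to b(X) T, so its square vanishes there and diagonalizability
     forces b(X) T = 0. *)
  have XB : X *m B = (X *m beta) 0 0 *: T.
    by rewrite mulmx_shift XA -scalerDl aj subrr scale0r add0r.
  have := diagonalizable_sq0 dB (X := X).
  rewrite XB -scalemxAl shift_kernel scaler0.
  by move=> /(_ erefl)/eqP; rewrite scaler_eq0 (negPf T0) orbF => /eqP.
(* A nonzero X makes r = - a a root of the characteristic polynomial. It is none of the [l j], so r
   = a = 0; then no [l j] is zero and X lies on the line of [T]. *)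
- apply: shift_diagonalizable => r X ra XA; left.
  have [X0|X0] := eqVneq X 0; first by rewrite X0 sub0mx.
  have : eigenvalue A r by apply/eigenvalueP; exists X.
  rewrite eigenvalue_root_char cA rootM rootX => /orP[/eqP r0|].
    apply: kernel_line; last by rewrite XA r0 scale0r.
    move=> j; apply/eqP => lj; apply: (al j).
    by rewrite lj oppr0 -ra r0 add0r.
  move=> /root_prod_XsubCP[j _ lj]; case: (al j).
  by rewrite lj; apply/eqP; rewrite -addr_eq0 addrC ra.
- apply: shift_diagonalizable => r X ra XA; right; apply/b0/bj.
  by rewrite XA; move/eqP: ra; rewrite aj subr_eq0 => /eqP ->.
Qed.

End RankOneShift.

(** * Second derivatives *)

Lemma is_derive_along_line (R : realType) (V W : normedModType R) (f : V -> W)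
    (u w : V) (s : R) : derivable f (s *: u + w) u ->
  is_derive s 1 (fun t => f (t *: u + w)) ('D_u f (s *: u + w)).
Proof.
have E : (fun h : R => h^-1 *: (f ((h *: 1 + s) *: u + w) - f (s *: u + w))) =
         (fun h : R => h^-1 *: (f (h *: u + (s *: u + w)) - f (s *: u + w))).
  by apply/funext => h; rewrite [h *: 1]mulr1 scalerDl addrA.
by move=> df; apply: DeriveDef; rewrite ?/derivable ?/derive /= E.
Qed.

(* Mean value theorem for s |-> f(x + s u + h v) - f(x + s u). *)
Lemma mixed_difference_bound (R : realType) (V : normedModType R) (f : V -> R)
    (x u v : V) : (\forall y \near x, differentiable f y) ->
  differentiable ('D_u f) x ->
  forall e, 0 < e -> \forall h \near (0 : R)^'+,
    `|f (h *: u + (h *: v + x)) - f (h *: v + x) - f (h *: u + x) + f x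
      - h ^+ 2 * 'D_v ('D_u f) x| <= e * h ^+ 2.
Proof.
move=> df dDf e e0.
(* The two remainders below are evaluated at c u + h v and c u, whose norms add up to at most h (2
   |u| + |v|); the 1 keeps [K] positive. *)
pose K := 2 * `|u| + `|v| + 1.
have K0 : 0 < K by rewrite /K; have := normr_ge0 u; have := normr_ge0 v; lra.
have [_ Hd] := (diff_locallyP _ _).1 dDf.
have /eqaddoP/(_ (e / K) (divr_gt0 e0 K0)) Hd' := Hd.
have df0 : \forall y \near (0 : V), differentiable f (y + x).
  move: df; rewrite nbhs0P; apply: filterS => y; by rewrite addrC.
have [d /= d0 Hdd] := (nbhs_norm0P).1 (filterI df0 Hd').
pose D := 'd ('D_u f) x.
have Hr w : `|w| < d -> `|'D_u f (w + x) - 'D_u f x - D w| <= e / K * `|w|.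
  by move=> wd; have := (Hdd w wd).2; rewrite /D -addrA -opprD.
near=> h.
have h0 : 0 < h by [].
have hK : h * K < d.
  by rewrite -ltr_pdivlMr //; near: h; apply: nbhs_right_lt; exact: divr_gt0.
have small (a b : R) : 0 <= a <= h -> 0 <= b <= h -> `|a *: u + b *: v| < d.
  move=> /andP[a0 ah] /andP[b0 bh]; apply: le_lt_trans hK.
  apply: le_trans (ler_normD _ _) _; rewrite !normrZ !ger0_norm //.
  have := normr_ge0 u; have := normr_ge0 v; rewrite /K; nra.
pose g s := f (s *: u + (h *: v + x)) - f (s *: u + x).
have dg s : 0 <= s <= h -> is_derive s 1 g
    ('D_u f (s *: u + (h *: v + x)) - 'D_u f (s *: u + x)).
  move=> sh; apply: is_deriveB; apply: is_derive_along_line;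
    apply: diff_derivable.
    rewrite addrA; apply: (Hdd _ _).1; apply: small => //; by rewrite lexx ltW.
  have := (Hdd (s *: u + 0 *: v) _).1; rewrite scale0r addr0; apply.
  by have := small s 0 sh; rewrite scale0r addr0; apply; rewrite lexx ltW.
have [||c /[!in_itv]/= /andP[c0 ch] gE] := @MVT R g
  (fun s => 'D_u f (s *: u + (h *: v + x)) - 'D_u f (s *: u + x)) 0 h h0.
- by move=> s; rewrite in_itv /= => /andP[s0 sh]; apply: dg; rewrite !ltW.
- apply: derivable_within_continuous => s; rewrite in_itv /= => sh.
  exact: (@ex_derive _ _ _ _ _ _ _ (dg s sh)).
have hh : 0 <= h <= h by rewrite lexx ltW.
have cc : 0 <= c <= h by rewrite !ltW.
have oo : (0 : R) <= 0 <= h by rewrite lexx ltW.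
have := Hr _ (small _ _ cc hh); have := Hr _ (small _ _ cc oo).
rewrite scale0r addr0 (deriveE v dDf) -/D.
set r0 := 'D_u f (c *: u + x) - _ - _; set r1 := _ - _ - D (_ + _).
move=> le0 le1.
(* After the mean value theorem only first-order remainders of 'D_u f are left: the linear parts at
   c u + h v and c u differ by exactly h D v. *)
have -> : f (h *: u + (h *: v + x)) - f (h *: v + x) - f (h *: u + x) + f x -
    h ^+ 2 * D v = h * (r1 - r0).
  have -> : f (h *: u + (h *: v + x)) - f (h *: v + x) - f (h *: u + x) + f x =
      g h - g 0 by rewrite /g !scale0r !add0r; ring.
  rewrite gE /r0 /r1 -(addrA (c *: u)).
  have -> : D (c *: u + h *: v) = D (c *: u) + h * D v.
    by rewrite linearD [X in _ + X = _]linearZ.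
  by ring.
rewrite normrM gtr0_norm // expr2 mulrCA ler_pM2l //.
apply: le_trans (ler_normB _ _) _; apply: le_trans (lerD le1 le0) _.
rewrite -mulrDr -[X in _ <= X * _](divfK (lt0r_neq0 K0)) -(mulrA _ K).
rewrite ler_pM2l ?divr_gt0 //.
have : `|c *: u + h *: v| <= h * `|u| + h * `|v|.
  apply: le_trans (ler_normD _ _) _; rewrite !normrZ !gtr0_norm //.
  by rewrite lerD2r ler_wpM2r // ltW.
have : `|c *: u| <= h * `|u| by rewrite normrZ gtr0_norm // ler_wpM2r // ltW.
by rewrite /K; lra.
Unshelve. all: by end_near.
Qed.

(** The second difference of f over the parallelogram with sides h u and h v is symmetric in u and
    v. Divided by h^2, it is within e / 2 of either mixed derivative for small positive h. *)
Lemma derive_comm (R : realType) (V : normedModType R) (f : V -> R)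
    (x u v : V) : (\forall y \near x, differentiable f y) ->
  differentiable ('D_u f) x -> differentiable ('D_v f) x ->
  'D_u ('D_v f) x = 'D_v ('D_u f) x.
Proof.
move=> df du dv; apply/eqP; rewrite -subr_eq0 -normr_le0.
apply/ler_addgt0Pl => e e0.
rewrite addr0; have e2 : 0 < e / 2 by lra.
have Hu := mixed_difference_bound v df du e2.
have Hv := mixed_difference_bound u df dv e2.
have [h [h0 [/= hu hv]]] :=
  @filter_ex _ ((0 : R)^'+) _ _ (filterI (nbhs_right_gt 0) (filterI Hu Hv)).
have h2 : 0 < h ^+ 2 by rewrite exprn_gt0.
rewrite -(ler_pM2l h2) -{1}(gtr0_norm h2) -normrM.
set A := (X in `|X - _| <= _) in hu.
set A' := (X in `|X - _| <= _) in hv.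
have AA : A = A'.
  rewrite /A /A' addrCA. ring.
move: AA hu hv.
move: A A' ('D_u ('D_v f) x) ('D_v ('D_u f) x) => A _ p q <- hu hv.
have -> : h ^+ 2 * (p - q) = (A - h ^+ 2 * q) - (A - h ^+ 2 * p) by ring.
apply: le_trans (ler_normB _ _) _; apply: le_trans (lerD hu hv) _.
by rewrite -mulrDl -splitr mulrC.
Qed.

(** * Rules for directional derivatives *)

Section DeriveRules.
Variables (R : realType) (V : normedModType R).
Implicit Types (f g : V -> R) (x u v : V).

Lemma derive_mulE f g x v : derivable f x v -> derivable g x v ->
  'D_v (fun y => f y * g y) x = 'D_v f x * g x + f x * 'D_v g x.
Proof.
move=> df dg; rewrite [LHS](deriveM df dg) addrC [g x *: _]mulrC.
by [].
Qed.

Lemma derive_sumE n (f : 'I_n -> V -> R) x v :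
  (forall i, derivable (f i) x v) ->
  'D_v (fun y => \sum_i f i y) x = \sum_i 'D_v (f i) x.
Proof.
move=> df; rewrite -derive_sum //; congr ('D_v _ x).
by apply/funext => y; rewrite fct_sumE.
Qed.

Lemma differentiable_sumE n (f : 'I_n -> V -> R) x :
  (forall i, differentiable (f i) x) ->
  differentiable (fun y => \sum_i f i y) x.
Proof.
move=> df; have := differentiable_sum df; congr (differentiable _ x).
by apply/funext => y; rewrite fct_sumE.
Qed.

Lemma derive_dirD f x u v : differentiable f x ->
  'D_(u + v) f x = 'D_u f x + 'D_v f x.
Proof. by move=> df; rewrite !deriveE ?linearD. Qed.

Lemma derive_dirZ f x (a : R) v : differentiable f x ->
  'D_(a *: v) f x = a * 'D_v f x.
Proof. by move=> df; rewrite !deriveE // [LHS]linearZ. Qed.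

Lemma derive_dir_sum n f x (v : 'I_n -> V) : differentiable f x ->
  'D_(\sum_i v i) f x = \sum_i 'D_(v i) f x.
Proof.
move=> df; rewrite deriveE // linear_sum; apply: eq_bigr => i _.
by rewrite deriveE.
Qed.

End DeriveRules.

(** The first-order expansion of [f] at [x] is also one of [g], and [diff_unique] identifies its
    linear part. This carries differentiability over from formulas that hold only off the zero
    section. *)
Lemma near_eq_differentiable (R : realType) (V W : normedModType R)
    (f g : V -> W) (x : V) :
  (\forall y \near x, f y = g y) -> differentiable f x -> differentiable g x.
Proof.
move=> fg df; have [c fE] := (diff_locallyP _ _).1 df.
have gE : g \o shift x = cst (g x) + 'd f x +o_0 id.
  apply/eqaddoP => e e0; move/eqaddoP: fE => /(_ e e0) fE.
  have fg0 : \forall w \near (0 : V), f (w + x) = g (w + x).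
    by move: fg; rewrite nbhs0P; apply: filterS => w; rewrite addrC.
  apply: filterS (filterI fg0 fE) => w [/= fgw].
  suff -> : (g \o shift x - (cst (g x) + 'd f x)) w =
      (f \o shift x - (cst (f x) + 'd f x)) w by [].
  by rewrite !fctE /= fgw (nbhs_singleton fg).
have := diff_unique c gE => dgE.
by apply/diff_locallyP; rewrite dgE.
Qed.

Lemma derive_linear_comp (R : realType) (V W W' : normedModType R)
    (L : {linear W -> W'}) (f : V -> W) x v :
  continuous L -> differentiable f x ->
  'D_v (L \o f) x = L ('D_v f x).
Proof.
move=> cL df; have dL : differentiable L (f x) by exact: linear_differentiable.
rewrite deriveE; last exact: differentiable_comp.
by rewrite (diff_comp df dL) /= (diff_lin (f x) cL) deriveE.
Qed.

(** * Sprays in a chart *)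

(** Named so that it can carry a linear structure, which makes it its own differential. *)
Definition fibre_coord (R : realType) (n : nat) (i : 'I_n)
  (z : coord_TM R n) : R := z.2 0 i.

Section FibreCoord.
Variables (R : realType) (n : nat) (i : 'I_n).

Lemma fibre_coord_is_linear : linear (@fibre_coord R n i).
Proof. by move=> a x y; rewrite /fibre_coord /= !mxE. Qed.

HB.instance Definition _ := GRing.isLinear.Build R (coord_TM R n) R *:%R
  (@fibre_coord R n i) fibre_coord_is_linear.

Lemma fibre_coord_continuous : continuous (@fibre_coord R n i).
Proof.
move=> z; apply: (@continuous_comp _ _ _ snd (fun v : 'rV[R]_n => v 0 i)).
  exact: cvg_snd.
exact: coord_continuous.
Qed.

Lemma fibre_coord_differentiable z : differentiable (@fibre_coord R n i) z.
Proof. by apply: linear_differentiable; exact: fibre_coord_continuous. Qed.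

Lemma derive_fibre_coord z v : 'D_v (@fibre_coord R n i) z = v.2 0 i.
Proof.
rewrite deriveE; last exact: fibre_coord_differentiable.
by rewrite diff_lin //; exact: fibre_coord_continuous.
Qed.

End FibreCoord.

Lemma derive_coords (R : realType) (n : nat) (g : coord_TM R n -> R)
    (z v : coord_TM R n) : differentiable g z ->
  'D_v g z = \sum_k v.1 0 k * 'D_(ddx R k) g z
    + \sum_k v.2 0 k * 'D_(ddxdot R k) g z.
Proof.
move=> dg.
have {1}-> : v = \sum_k v.1 0 k *: ddx R k + \sum_k v.2 0 k *: ddxdot R k.
  have fstD : {morph @fst 'rV[R]_n 'rV[R]_n : x y / x + y} by [].
  have sndD : {morph @snd 'rV[R]_n 'rV[R]_n : x y / x + y} by [].
  rewrite [LHS]surjective_pairing [RHS]surjective_pairing; congr pair.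
    rewrite /= !(big_morph _ fstD erefl) /=.
    rewrite [X in _ + X]big1 ?addr0; last by move=> k _; rewrite scaler0.
    exact: row_sum_delta.
  rewrite /= !(big_morph _ sndD erefl) /=.
  rewrite big1 ?add0r; last by move=> k _; rewrite scaler0.
  exact: row_sum_delta.
rewrite derive_dirD // !derive_dir_sum //.
by congr (_ + _); apply: eq_bigr => k _; rewrite derive_dirZ.
Qed.

Lemma slit_coords_open (R : realType) (n : nat) (M : manifold R n)
    (c : chart_idx M) :
  open (slit_coords c).
Proof.
have -> : slit_coords c = (fst @^-1` cod c) `&` (snd @^-1` (~` [set 0])).
  by apply/seteqP; split=> z [/= cz z0]; split=> //; apply/eqP.
apply: openI.
  by apply: open_comp; [move=> z _; exact: cvg_fst|exact: cod_open].
apply: open_comp; first by move=> z _; exact: cvg_snd.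
apply: closed_openC; apply: compact_closed; first exact: norm_hausdorff.
exact: compact_set1.
Qed.

(** The regularity that lets Euler's relation be differentiated once and mixed derivatives be
    exchanged. *)
Definition differentiable2_on (R : realType) (V : normedModType R) (A : set V)
    (g : V -> R) :=
  forall x, A x -> differentiable g x /\ forall u, differentiable ('D_u g) x.

Lemma open_near (T : topologicalType) (A Q : set T) (x : T) :
  open A -> A x -> A `<=` Q -> \forall y \near x, Q y.
Proof. by move=> oA Ax AQ; apply: filterS AQ _; exact: open_nbhs_nbhs. Qed.

(** * Euler's relation and its derivatives *)

Section Euler.
Variables (R : realType) (n : nat) (A : set (coord_TM R n)).
Hypothesis oA : open A.
Implicit Types (g : coord_TM R n -> R) (z : coord_TM R n).

Lemma eq_on_derive g h z v : A z -> (forall w, A w -> g w = h w) ->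
  'D_v g z = 'D_v h z.
Proof. by move=> Az gh; apply: near_eq_derive; exact: open_near gh. Qed.

Lemma derive_comm_on g z u v : differentiable2_on A g -> A z ->
  'D_u ('D_v g) z = 'D_v ('D_u g) z.
Proof.
move=> g2 Az; apply: derive_comm; try by case: (g2 z Az).
by apply: open_near Az _ => // w /g2[].
Qed.

Lemma derive_vertical g z (v : 'rV[R]_n) : differentiable g z ->
  'D_(0, v) g z = \sum_k v 0 k * 'D_(ddxdot R k) g z.
Proof.
move=> dg; refine (etrans (derive_coords (0, v) dg) _).
by rewrite big1 ?add0r // => k _; rewrite mxE mul0r.
Qed.

(** Differentiate the sum of xdot^k dg/dxdot^k = r g with respect to xdot^j: the coefficient xdot^j
    contributes one extra dg/dxdot^j, and the mixed derivatives commute. The degree drops by one. *)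
Lemma derive_euler g (r : R) (j : 'I_n) z : differentiable2_on A g -> A z ->
  (forall w, A w -> 'D_(0, w.2) g w = r * g w) ->
  'D_(0, z.2) ('D_(ddxdot R j) g) z = (r - 1) * 'D_(ddxdot R j) g z.
Proof.
move=> g2 Az euler; have [dg dDg] := g2 z Az.
have E : 'D_(ddxdot R j)
      (fun w => \sum_k fibre_coord k w * 'D_(ddxdot R k) g w) z =
    'D_(ddxdot R j) (fun w => r * g w) z.
  apply: eq_on_derive => // w Aw.
  by rewrite -euler // derive_vertical //; case: (g2 w Aw).
have df k : differentiable (fun w => fibre_coord k w * 'D_(ddxdot R k) g w) z.
  by apply: differentiableM => //; exact: fibre_coord_differentiable.
move: E; rewrite derive_sumE; last by move=> k; exact: diff_derivable.
rewrite derive_mulE; [|exact: derivable_cst|exact: diff_derivable].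
rewrite derive_cst mul0r add0r => E.
rewrite mulrBl mul1r -E derive_vertical //.
rewrite -(addrK ('D_(ddxdot R j) g z) (\sum_(i < n) z.2 0 i * _)).
congr (_ - _); rewrite addrC.
(* The extra term is written as a sum against a Kronecker delta, to match the product rule term by
   term. *)
have -> : 'D_(ddxdot R j) g z =
    \sum_k 'D_(ddxdot R j) (@fibre_coord R n k) z * 'D_(ddxdot R k) g z.
  rewrite (bigD1 j) //= big1 ?addr0.
    by rewrite derive_fibre_coord mxE !eqxx mul1r.
  by move=> k kj; rewrite derive_fibre_coord mxE (negPf kj) andbF mul0r.
rewrite -big_split /=; apply: eq_bigr => k _.
rewrite derive_mulE;
  try (apply: diff_derivable => //; exact: fibre_coord_differentiable).
by rewrite derive_comm_on.
Qed.

End Euler.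

(** * Regularity and homogeneity of P and of the force in a chart *)

Section Chart.
Variables (R : realType) (n : nat) (M : manifold R n) (c : chart_idx M).

(** [slit] asks for nonzero components in every chart; a zero component in one chart would give zero
    in [c] by the transition law. *)
Lemma slit_tangent_at z : slit_coords c z -> slit M (tangent_at c z).
Proof.
case=> cz z0 d dv; apply: contra_neq z0 => vd0.
have cv : dom c (foot (tangent_at c z)).
  by case: cz => q cq /= <-; rewrite chartK.
have <- : tcomp (tangent_at c z) c = z.2.
  by rewrite -[RHS](congr1 snd (tangent_atK cz)).
by rewrite (tcomp_law dv cv) vd0 derive0.
Qed.

Lemma slit_coordsP (v : tangent M) : slit M v -> dom c (foot v) ->
  slit_coords c (coords c v).
Proof. by move=> sv cv; split; [exists (foot v)|exact: sv]. Qed.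

Lemma local_homogeneous (P : tangent M -> R) (z : coord_TM R n) (mu : R) :
  pos_homogeneous P -> slit_coords c z -> 0 < mu ->
  local P c (z.1, mu *: z.2) = mu * local P c z.
Proof.
move=> hP Oz mu0; have [cz _] := Oz.
rewrite /local -hP //; last exact: slit_tangent_at.
congr P; rewrite -[RHS](@coordsK _ _ _ c).
  congr tangent_at; have zE := esym (tangent_atK cz); congr pair.
    exact: (congr1 fst zE).
  exact: (congr1 (fun w => mu *: w.2) zE).
by case: cz => q cq /= <-; rewrite chartK.
Qed.

(** Along the fibre direction the point becomes (x, (1 + h) xdot). For |h| < 1 homogeneity applies
    and the difference quotient is constant, so its limit is immediate. *)
Lemma local_euler (P : tangent M -> R) (z : coord_TM R n) :
  pos_homogeneous P -> slit_coords c z ->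
  'D_(0, z.2) (local P c) z = local P c z.
Proof.
move=> hP Oz.
have E : \forall h \near (0 : R)^',
    h^-1 *: (local P c (h *: (0, z.2) + z) - local P c z) = local P c z.
  near=> h.
  have h0 : h != 0 by near: h; exact: nbhs_dnbhs_neq.
  have h1 : 0 < 1 + h.
    have : `|h| < 1 by near: h; exact: dnbhs0_lt.
    by rewrite ltr_norml; lra.
  have -> : h *: (0, z.2) + z = (z.1, (1 + h) *: z.2).
    by rewrite [LHS]surjective_pairing /= scaler0 add0r scalerDl scale1r addrC.
  rewrite local_homogeneous // mulrDl mul1r addrAC subrr add0r.
  by rewrite [LHS]mulKf.
exact: lim_near_cst E.
Unshelve. all: by end_near.
Qed.

Lemma smooth_function_differentiable2 (P : tangent M -> R) :
  smooth_function P -> differentiable2_on (slit_coords c) (local P c).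
Proof.
move=> sP z Oz; split=> [|u]; first exact: (sP c [::] z Oz).
exact: (sP c [:: u] z Oz).
Qed.

Variable S : vfield M.
Hypothesis hS : is_spray S.

Lemma force_differentiable2 i :
  differentiable2_on (slit_coords c) (force S c i).
Proof.
have [[sS _] _ _] := hS.
have comp (g : coord_TM R n -> coord_TM R n) z : differentiable g z ->
    differentiable (@fibre_coord R n i \o g) z.
  move=> dg; apply: differentiable_comp => //.
  exact: fibre_coord_differentiable.
move=> z Oz; split=> [|u]; first by apply: comp; exact: (sS c [::] z Oz).
(* Taking a component commutes with 'D_u only where [S c] is known to be differentiable, hence the
   restriction to a neighbourhood. *)
apply: near_eq_differentiable (comp _ _ (sS c [:: u] z Oz)).
apply: open_near Oz _ => [|w Ow]; first exact: slit_coords_open.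
rewrite /= -derive_linear_comp //; first exact: fibre_coord_continuous.
exact: (sS c [::] w Ow).
Qed.

Lemma derive_liouville z v : 'D_v (liouville M c) z = (0, v.2).
Proof.
apply: lim_near_cst; first exact: norm_hausdorff.
near=> h; have h0 : h != 0 by near: h; exact: nbhs_dnbhs_neq.
rewrite [LHS]surjective_pairing /= subrr scaler0 addrK scalerA mulVf //.
by rewrite scale1r.
Unshelve. all: by end_near.
Qed.

(** The fibre part of [Delta, S] = S reads Delta(f^i) - f^i = f^i, since differentiating Delta along
    S returns the force. *)
Lemma force_euler i z : slit_coords c z ->
  'D_(0, z.2) (force S c i) z = 2 * force S c i z.
Proof.
move=> Oz; have [[sS _] _ /(_ c z Oz)/(congr1 (@fibre_coord R n i))] := hS.
rewrite /lie_bracket linearB /= derive_liouville.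
rewrite -(derive_linear_comp _ (@fibre_coord_continuous R n i)
  (sS c [::] z Oz)).
move/(canRL (subrK _)) => ->.
by rewrite mulr2n mulrDl mul1r.
Qed.

Lemma spray_fst z : slit_coords c z -> (S c z).1 = z.2.
Proof. by move=> Oz; case: hS => _ h _; exact: h. Qed.

End Chart.

(** * The connection coefficients and Phi(T) = 0 *)

Section Spray.
Variables (R : realType) (n : nat) (M : manifold R n) (c : chart_idx M).
Variable S : vfield M.
Hypothesis hS : is_spray S.

Lemma derive_spray g z : slit_coords c z -> differentiable g z ->
  'D_(S c z) g z = \sum_k z.2 0 k * 'D_(ddx R k) g z
    + \sum_k force S c k z * 'D_(ddxdot R k) g z.
Proof. by move=> Oz dg; rewrite derive_coords // spray_fst. Qed.

Lemma derive_force i j z :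
  'D_(ddxdot R j) (force S c i) z = - 2 * Gamma S c i j z.
Proof. by rewrite /Gamma mulrA mulrNN mul1r mulfV ?mul1r // pnatr_eq0. Qed.

Lemma Gamma_differentiable i j z : slit_coords c z ->
  differentiable (Gamma S c i j) z.
Proof.
move=> Oz; have [_ df] := force_differentiable2 hS i Oz.
by apply: differentiableM => //; exact: differentiable_cst.
Qed.

(** This is Euler's relation for the force: the degree 2 cancels the factor 1/2 in Gamma. *)
Lemma Gamma_vertical i z : slit_coords c z ->
  \sum_k Gamma S c i k z * z.2 0 k = - force S c i z.
Proof.
move=> Oz; have [df _] := force_differentiable2 hS i Oz.
have := force_euler hS i Oz; rewrite derive_vertical // => E.
have -> : force S c i z = 1 / 2 * (2 * force S c i z).
  by rewrite mulrA mulfVK ?mul1r // pnatr_eq0.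
rewrite -E mulr_sumr -sumrN; apply: eq_bigr => k _.
by rewrite /Gamma mulrAC -mulrA mulNr.
Qed.

(** [Gamma_vertical] is differentiated along S. This evaluates the contraction of S(Gamma^i_j) with
    xdot^j as - [Y] + [GF], which cancels the other two terms of Phi. *)
Lemma jacobi_annihilates_T i z : slit_coords c z ->
  \sum_j z.2 0 j * jacobi_comp S c z i j = 0.
Proof.
move=> Oz; have [df _] := force_differentiable2 hS i Oz.
have dG k : differentiable (Gamma S c i k) z by exact: Gamma_differentiable.
have dy k : differentiable (@fibre_coord R n k) z.
  exact: fibre_coord_differentiable.
have E : 'D_(S c z) (fun w => \sum_k Gamma S c i k w * fibre_coord k w) z =
   'D_(S c z) (fun w => (-1) * force S c i w) z.
  apply: (eq_on_derive (@slit_coords_open _ _ _ c)) Oz _ => w Ow.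
  by rewrite Gamma_vertical // mulN1r.
move: E; rewrite derive_sumE; last first.
  by move=> k; apply: diff_derivable; exact: differentiableM.
rewrite derive_mulE; [|exact: derivable_cst|exact: diff_derivable].
rewrite derive_cst mul0r add0r derive_spray // => E.
pose Y := \sum_k z.2 0 k * 'D_(ddx R k) (force S c i) z.
pose GF := \sum_k Gamma S c i k z * force S c k z.
have {}E : \sum_k 'D_(S c z) (Gamma S c i k) z * z.2 0 k + GF = - Y + 2 * GF.
  move: E; rewrite mulrDr mulN1r -/Y => E.
  rewrite -big_split /= (_ : 2 * GF =
    -1 * \sum_k force S c k z * 'D_(ddxdot R k) (force S c i) z).
    rewrite -E; apply: eq_bigr => k _.
    by rewrite derive_mulE ?derive_fibre_coord //; exact: diff_derivable.
  rewrite mulr_sumr mulr_sumr; apply: eq_bigr => k _.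
  rewrite derive_force; ring.
(* Summing over j first turns Gamma^k_j xdot^j into - f^k. *)
have A : \sum_j z.2 0 j * (\sum_k Gamma S c k j z * Gamma S c i k z) = - GF.
  under eq_bigr do rewrite mulr_sumr.
  rewrite exchange_big /= -sumrN; apply: eq_bigr => k _.
  rewrite -mulrN -Gamma_vertical // mulr_sumr; apply: eq_bigr => j _.
  by rewrite mulrC -mulrA mulrCA.
under eq_bigr => j _ do rewrite /jacobi_comp !mulrDr !mulrN.
rewrite !big_split /= !sumrN A -/Y.
have -> : \sum_j z.2 0 j * 'D_(S c z) (Gamma S c i j) z = - Y + GF.
  under eq_bigr do rewrite mulrC.
  by apply: (addIr GF); rewrite E mulr2n mulrDl mul1r addrA.
by rewrite opprK opprD opprK addrACA addNr subrr addr0.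
Qed.

End Spray.

(** * Projective changes *)

Lemma sum_delta (R : pzRingType) (n : nat) (j : 'I_n) (F : 'I_n -> R) :
  \sum_k (k == j)%:R * F k = F j.
Proof.
rewrite (bigD1 j) //= eqxx mul1r big1 ?addr0 // => k /negPf->.
by rewrite mul0r.
Qed.

(** The quadratic term of Phi~: [g] is Gamma, [q] the fibre gradient of P, [y] is xdot, [s] is P and
    [t] is f^i. The two premises are the Euler contractions of Gamma and of P. *)
Lemma sum_rank_one_shift (R : comNzRingType) (n : nat) (g : 'I_n -> 'I_n -> R)
    (q y : 'I_n -> R) (s t : R) (i j : 'I_n) :
  \sum_k g i k * y k = - t -> \sum_k q k * y k = s ->
  \sum_k (g k j + s * (k == j)%:R + q j * y k) *
          (g i k + s * (i == k)%:R + q k * y i) =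
  \sum_k g k j * g i k + 2 * s * g i j + s ^+ 2 * (i == j)%:R
  + y i * (\sum_k g k j * q k + 3 * s * q j) - q j * t.
Proof.
move=> gy qy; transitivity (\sum_k g k j * g i k
  + \sum_k (k == j)%:R * (s * (g i k + s * (i == k)%:R + q k * y i))
  + \sum_k (k == i)%:R * (s * (g k j + q j * y k))
  + y i * \sum_k g k j * q k
  + q j * \sum_k g i k * y k
  + q j * y i * \sum_k q k * y k).
  rewrite !mulr_sumr -!big_split /=; apply: eq_bigr => k _.
  rewrite (eq_sym i k); ring.
rewrite !sum_delta gy qy; ring.
Qed.

(** Regroups X^H(P) by the components of X, with [a] and [q] the base and fibre derivatives of P. *)
Lemma sum_horizontal (R : comNzRingType) (n : nat) (X : 'rV[R]_n)
    (g : 'I_n -> 'I_n -> R) (a q : 'I_n -> R) :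
  \sum_k X 0 k * a k
    + \sum_k (- \row_(j < n) \sum_(i < n) X 0 i * g j i) 0 k * q k =
  \sum_j X 0 j * (a j - \sum_k g k j * q k).
Proof.
under [RHS]eq_bigr do rewrite mulrBr.
rewrite sumrB; congr (_ + _); under eq_bigr do rewrite !mxE mulNr mulr_suml.
rewrite sumrN exchange_big /=; congr (- _).
apply: eq_bigr => j _; rewrite mulr_sumr.
by apply: eq_bigr => k _; rewrite mulrA.
Qed.

Lemma weighted_sum_three (R : comNzRingType) (n : nat) (x h q s : 'I_n -> R)
    (r t : R) :
  \sum_j x j * (r * h j - t * q j - s j) =
  r * \sum_j x j * h j - t * \sum_j x j * q j - \sum_j x j * s j.
Proof.
by rewrite !mulr_sumr -!sumrB; apply: eq_bigr => j _; ring.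
Qed.

Lemma weighted_sum_four (R : comNzRingType) (n : nat) (x a h q s : 'I_n -> R)
    (r t : R) :
  \sum_j x j * (r * a j - h j - t * q j - s j) =
  r * \sum_j x j * a j - \sum_j x j * h j - t * \sum_j q j * x j
    - \sum_j x j * s j.
Proof.
by rewrite !mulr_sumr -!sumrB; apply: eq_bigr => j _; ring.
Qed.

Section ProjectiveChange.
Variables (R : realType) (n : nat) (M : manifold R n) (c : chart_idx M).
Variables (S : vfield M) (P : tangent M -> R).
Hypotheses (hS : is_spray S) (smoothP : smooth_function P).
Hypothesis homP : pos_homogeneous P.

Local Notation p := (local P c).
Local Notation S' := (projective_change S P).
Local Notation y i := (@fibre_coord R n i).
Local Notation G := (Gamma S c).

Lemma derive_fibre_coord_ddxdot i j z :
  'D_(ddxdot R j) (y i) z = (i == j)%:R.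
Proof. by rewrite derive_fibre_coord mxE eqxx. Qed.

Let diffp z : slit_coords c z -> differentiable p z.
Proof. by move=> Oz; case: (smooth_function_differentiable2 smoothP Oz). Qed.

Let diffdp z u : slit_coords c z -> differentiable ('D_u p) z.
Proof. by move=> Oz; case: (smooth_function_differentiable2 smoothP Oz). Qed.

Let diffy i z : differentiable (y i) z.
Proof. exact: fibre_coord_differentiable. Qed.

Let diffG i j z : slit_coords c z -> differentiable (G i j) z.
Proof. exact: Gamma_differentiable. Qed.

Lemma force_projective_change i z :
  force S' c i z = force S c i z - 2 * (p z * y i z).
Proof. by rewrite /force /= !mxE /fibre_coord mulrA. Qed.

Lemma derive_projective_change g z : differentiable g z ->
  'D_(S' c z) g z = 'D_(S c z) g z - 2 * p z * 'D_(0, z.2) g z.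
Proof.
by move=> dg; rewrite derive_dirD // -scaleNr derive_dirZ // mulNr.
Qed.

Lemma derive_force_projective_change i v z : slit_coords c z ->
  'D_v (force S' c i) z =
  'D_v (force S c i) z - 2 * ('D_v p z * y i z + p z * v.2 0 i).
Proof.
move=> Oz; have [df _] := force_differentiable2 hS i Oz.
have dpy : differentiable (fun w => p w * y i w) z.
  by apply: differentiableM => //; exact: diffp.
have -> : force S' c i = fun w => force S c i w + (- 2) * (p w * y i w).
  by apply/funext => w; rewrite force_projective_change mulNr.
rewrite [LHS]deriveD; last 2 first.
- exact: diff_derivable.
- by apply: diff_derivable; exact: differentiableM.
rewrite derive_mulE; [|exact: derivable_cst|exact: diff_derivable].
rewrite derive_cst mul0r add0r mulNr derive_mulE; last 2 first.
- by apply: diff_derivable; exact: diffp.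
- exact: diff_derivable.
by rewrite derive_fibre_coord.
Qed.

Lemma Gamma_projective_change i j z : slit_coords c z ->
  Gamma S' c i j z =
  G i j z + p z * (i == j)%:R + 'D_(ddxdot R j) p z * y i z.
Proof.
move=> Oz; rewrite /Gamma derive_force_projective_change //.
have -> : (ddxdot R j).2 0 i = (i == j)%:R by rewrite mxE eqxx.
by field.
Qed.

Lemma sum_derive_p z : slit_coords c z ->
  \sum_k 'D_(ddxdot R k) p z * z.2 0 k = p z.
Proof.
move=> Oz; rewrite -[RHS](local_euler homP Oz) derive_vertical;
  last exact: diffp.
by apply: eq_bigr => k _; rewrite mulrC.
Qed.

Lemma Gamma_projective_change_differentiable i j z : slit_coords c z ->
  differentiable (Gamma S' c i j) z.
Proof.
move=> Oz.
have near_eq : \forall w \near z, G i j w + p w * (i == j)%:R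
    + 'D_(ddxdot R j) p w * y i w = Gamma S' c i j w.
  apply: open_near Oz _ => [|w Ow /=]; first exact: slit_coords_open.
  by rewrite Gamma_projective_change.
apply: near_eq_differentiable near_eq _.
apply: differentiableD; first apply: differentiableD.
- exact: diffG.
- by apply: differentiableM; [exact: diffp|exact: differentiable_cst].
- by apply: differentiableM => //; exact: diffdp.
Qed.

Lemma derive_Gamma_projective_change i j v z : slit_coords c z ->
  'D_v (Gamma S' c i j) z = 'D_v (G i j) z + 'D_v p z * (i == j)%:R
    + ('D_v ('D_(ddxdot R j) p) z * y i z + 'D_(ddxdot R j) p z * v.2 0 i).
Proof.
move=> Oz.
have dpd : differentiable (fun w => p w * (i == j)%:R) z.
  by apply: differentiableM; [exact: diffp|exact: differentiable_cst].
have dpy : differentiable (fun w => 'D_(ddxdot R j) p w * y i w) z.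
  by apply: differentiableM => //; exact: diffdp.
rewrite (eq_on_derive (@slit_coords_open _ _ _ c) _ Oz
  (fun w => @Gamma_projective_change i j w)).
rewrite [LHS]deriveD; last 2 first.
- by apply: diff_derivable; apply: differentiableD => //; exact: diffG.
- exact: diff_derivable.
congr (_ + _).
  rewrite [LHS]deriveD; last 2 first.
  - by apply: diff_derivable; exact: diffG.
  - exact: diff_derivable.
  congr (_ + _); rewrite derive_mulE; last 2 first.
  - by apply: diff_derivable; exact: diffp.
  - exact: derivable_cst.
  by rewrite derive_cst mulr0 addr0.
rewrite derive_mulE ?derive_fibre_coord //; last exact: diff_derivable.
by apply: diff_derivable; exact: diffdp.
Qed.

(** Gamma is 1-homogeneous, being a fibre derivative of the 2-homogeneous force. *)
Lemma derive_vertical_Gamma i j z : slit_coords c z ->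
  'D_(0, z.2) (G i j) z = G i j z.
Proof.
move=> Oz; have f2 := @force_differentiable2 _ _ _ c _ hS i.
have [_ df] := f2 z Oz.
rewrite derive_mulE; [|exact: derivable_cst|exact: diff_derivable].
rewrite derive_cst mul0r add0r.
rewrite (derive_euler (@slit_coords_open _ _ _ c) j f2 Oz (force_euler hS i)).
have -> : (2 : R) - 1 = 1 by ring.
by rewrite /Gamma; congr (_ * _); exact: mul1r.
Qed.

Lemma derive_vertical_p j z : slit_coords c z ->
  'D_(0, z.2) ('D_(ddxdot R j) p) z = 0.
Proof.
move=> Oz.
have p2 := @smooth_function_differentiable2 _ _ _ c _ smoothP.
rewrite (derive_euler (r := 1) (@slit_coords_open _ _ _ c) j p2 Oz).
  by rewrite subrr mul0r.
by move=> w Ow; rewrite mul1r local_euler.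
Qed.

(** The components of b in the form in which the computation of Phi~ produces them, with S applied
    after the fibre derivative of P; [proj_bE] matches them with the intrinsic formula. *)
Definition proj_b_comp z j : R :=
  2 * 'D_(ddx R j) p z - \sum_k G k j z * 'D_(ddxdot R k) p z
  - p z * 'D_(ddxdot R j) p z - 'D_(S c z) ('D_(ddxdot R j) p) z.

Lemma sum_Gamma_projective_change i j z : slit_coords c z ->
  \sum_k Gamma S' c k j z * Gamma S' c i k z =
  \sum_k G k j z * G i k z + 2 * p z * G i j z + p z ^+ 2 * (i == j)%:R
  + z.2 0 i * (\sum_k G k j z * 'D_(ddxdot R k) p z
               + 3 * p z * 'D_(ddxdot R j) p z)
  - 'D_(ddxdot R j) p z * force S c i z.
Proof.
move=> Oz.
rewrite (eq_bigr _ (fun k _ => congr2 *%R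
  (Gamma_projective_change k j Oz) (Gamma_projective_change i k Oz))).
exact: (@sum_rank_one_shift R n (fun i k => G i k z)
  (fun k => 'D_(ddxdot R k) p z) (fun k => z.2 0 k) _ _ i j
  (Gamma_vertical hS i Oz) (sum_derive_p Oz)).
Qed.

(** In S~ = S - 2 P Delta the part Delta acts on Gamma, P and the fibre derivatives of P by their
    degrees 1, 1 and 0. The terms in Gamma^i_j and in f^i then cancel, leaving a on the diagonal and
    b in front of xdot^i. *)
Lemma jacobi_comp_projective_change i j z : slit_coords c z ->
  jacobi_comp S' c z i j = jacobi_comp S c z i j
    + proj_a S P c z * (i == j)%:R + proj_b_comp z j * z.2 0 i.
Proof.
move=> Oz.
have Ef := derive_force_projective_change i (ddx R j) Oz.
have EG := sum_Gamma_projective_change i j Oz.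
have ES := derive_projective_change
  (Gamma_projective_change_differentiable i j Oz).
rewrite (derive_Gamma_projective_change i j (S c z) Oz) in ES.
rewrite (derive_Gamma_projective_change i j (0, z.2) Oz) in ES.
rewrite (derive_vertical_Gamma i j Oz) (local_euler homP Oz) in ES.
rewrite (derive_vertical_p j Oz) in ES.
have comb (A A' B B' C C' : R) : A = A' -> B = B' -> C = C' ->
  - A - B - C = - A' - B' - C' by move=> -> -> ->.
refine (etrans (comb _ _ _ _ _ _ Ef EG ES) _).
have -> : (ddx R j).2 0 i = 0 by rewrite mxE.
have -> : (S c z).2 0 i = force S c i z by [].
rewrite /jacobi_comp /proj_a /S_of_P /proj_b_comp /fibre_coord /=.
generalize ('D_(S c z) ('D_(ddxdot R j) p) z) ('D_(S c z) p z)
  ('D_(S c z) (G i j) z) ('D_(ddxdot R j) p z) ('D_(ddx R j) p z)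
  ('D_(ddx R j) (force S c i) z) (\sum_k G k j z * 'D_(ddxdot R k) p z)
  (\sum_k G k j z * G i k z) (p z) (G i j z) (force S c i z).
move=> *; ring.
Qed.

(** The direction of differentiation in S(P) varies with the point; coordinates turn S(P) into
    products of functions with derivatives in fixed directions, which can be differentiated
    again. *)
Lemma S_of_P_coords z : slit_coords c z ->
  S_of_P S P c z = \sum_k y k z * 'D_(ddx R k) p z
    + \sum_k force S c k z * 'D_(ddxdot R k) p z.
Proof. by move=> Oz; rewrite /S_of_P derive_spray //; exact: diffp. Qed.

Let diff_xsum k z : slit_coords c z ->
  differentiable (fun w => y k w * 'D_(ddx R k) p w) z.
Proof. by move=> Oz; apply: differentiableM => //; exact: diffdp. Qed.

Let diff_fsum k z : slit_coords c z ->
  differentiable (fun w => force S c k w * 'D_(ddxdot R k) p w) z.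
Proof.
move=> Oz; have [df _] := force_differentiable2 hS k Oz.
by apply: differentiableM => //; exact: diffdp.
Qed.

Lemma S_of_P_differentiable z : slit_coords c z ->
  differentiable (S_of_P S P c) z.
Proof.
move=> Oz; have near_eq : \forall w \near z, \sum_k y k w * 'D_(ddx R k) p w
    + \sum_k force S c k w * 'D_(ddxdot R k) p w = S_of_P S P c w.
  apply: open_near Oz _ => [|w Ow /=]; first exact: slit_coords_open.
  by rewrite S_of_P_coords.
apply: near_eq_differentiable near_eq _.
apply: differentiableD; apply: differentiable_sumE => k.
  exact: diff_xsum.
exact: diff_fsum.
Qed.

(** This is the commutator [d/dxdot^j, S] = d/dx^j - 2 Gamma^k_j d/dxdot^k applied to P. *)
Lemma derive_S_of_P j z : slit_coords c z ->
  'D_(ddxdot R j) (S_of_P S P c) z = 'D_(ddx R j) p z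
    + 'D_(S c z) ('D_(ddxdot R j) p) z
    - 2 * \sum_k G k j z * 'D_(ddxdot R k) p z.
Proof.
move=> Oz.
have p2 := @smooth_function_differentiable2 _ _ _ c _ smoothP.
have oO := @slit_coords_open _ _ _ c.
have df k : differentiable (force S c k) z.
  by have [] := force_differentiable2 hS k Oz.
have dsx := differentiable_sumE (fun k => diff_xsum k Oz).
have dsf := differentiable_sumE (fun k => diff_fsum k Oz).
have Ex : 'D_(ddxdot R j) (fun w => \sum_k y k w * 'D_(ddx R k) p w) z =
    'D_(ddx R j) p z + \sum_k z.2 0 k * 'D_(ddx R k) ('D_(ddxdot R j) p) z.
  refine (etrans (derive_sumE (fun k => diff_derivable (diff_xsum k Oz))) _).
  rewrite -[X in _ = X + _](sum_delta j (fun k => 'D_(ddx R k) p z)).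
  rewrite -big_split /=; apply: eq_bigr => k _.
  refine (etrans (derive_mulE (diff_derivable (diffy k z))
    (diff_derivable (diffdp (ddx R k) Oz))) _).
  exact: (congr2 +%R (congr1 ( *%R^~ _) (derive_fibre_coord_ddxdot k j z))
    (congr1 ( *%R _) (derive_comm_on oO (ddxdot R j) (ddx R k) p2 Oz))).
have Ef : 'D_(ddxdot R j)
      (fun w => \sum_k force S c k w * 'D_(ddxdot R k) p w) z =
    - 2 * \sum_k G k j z * 'D_(ddxdot R k) p z
    + \sum_k force S c k z * 'D_(ddxdot R k) ('D_(ddxdot R j) p) z.
  refine (etrans (derive_sumE (fun k => diff_derivable (diff_fsum k Oz))) _).
  rewrite mulr_sumr -big_split /=; apply: eq_bigr => k _.
  refine (etrans (derive_mulE (diff_derivable (df k))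
    (diff_derivable (diffdp (ddxdot R k) Oz))) _).
  rewrite mulrA.
  exact: (congr2 +%R (congr1 ( *%R^~ _) (@derive_force R n M c S k j z))
    (congr1 ( *%R _) (derive_comm_on oO (ddxdot R j) (ddxdot R k) p2 Oz))).
refine (etrans (eq_on_derive oO _ Oz S_of_P_coords) _).
refine (etrans (deriveD (diff_derivable dsx) (diff_derivable dsf)) _).
refine (etrans (congr2 +%R Ex Ef) _).
have := derive_spray hS Oz (diffdp (ddxdot R j) Oz).
generalize ('D_(S c z) ('D_(ddxdot R j) p) z) => t ->.
by rewrite -addrA -addrA mulNr; congr (_ + _); rewrite [LHS]addrCA addrC -addrA.
Qed.

Lemma proj_b_comp_split j z : slit_coords c z ->
  proj_b_comp z j =
  3 * ('D_(ddx R j) p z - \sum_k G k j z * 'D_(ddxdot R k) p z)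
  - p z * 'D_(ddxdot R j) p z - 'D_(ddxdot R j) (S_of_P S P c) z.
Proof.
move=> Oz; rewrite /proj_b_comp; have := derive_S_of_P j Oz.
generalize ('D_(ddxdot R j) (S_of_P S P c) z) => t ->.
generalize ('D_(S c z) ('D_(ddxdot R j) p) z) ('D_(ddxdot R j) p z)
  ('D_(ddx R j) p z) (\sum_k G k j z * 'D_(ddxdot R k) p z) (p z).
by move=> *; ring.
Qed.

Lemma proj_bE z (X : 'rV[R]_n) : slit_coords c z ->
  proj_b S P c z X = \sum_j X 0 j * proj_b_comp z j.
Proof.
move=> Oz; have dp := diffp Oz.
have Eh := derive_coords (hlift S c z X) dp.
rewrite (sum_horizontal X (fun j i => G j i z)) in Eh.
have Ev := derive_vertical X dp.
have Es := derive_vertical X (S_of_P_differentiable Oz).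
rewrite (eq_bigr _ (fun j _ => congr1 ( *%R _) (proj_b_comp_split j Oz))).
rewrite weighted_sum_three.
have comb (A A' B B' C C' q : R) : A = A' -> B = B' -> C = C' ->
  3 * A - q * B - C = 3 * A' - q * B' - C' by move=> -> -> ->.
exact: (comb _ _ _ _ _ _ (p z) Eh Ev Es).
Qed.

(** Differentiating Euler's relation for P along S and comparing with S(P) in coordinates shows that
    dP/dx^k and S(dP/dxdot^k) have the same contraction with xdot^k. What remains is S(P) - P^2. *)
Lemma proj_b_T z : slit_coords c z ->
  \sum_j z.2 0 j * proj_b_comp z j = - proj_a S P c z.
Proof.
move=> Oz.
have dyp k : differentiable (fun w => 'D_(ddxdot R k) p w * y k w) z.
  by apply: differentiableM => //; exact: diffdp.
have E : S_of_P S P c z = \sum_k z.2 0 k * 'D_(S c z) ('D_(ddxdot R k) p) z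
    + \sum_k force S c k z * 'D_(ddxdot R k) p z.
  refine (etrans (esym (eq_on_derive (@slit_coords_open _ _ _ c) (S c z) Oz
    sum_derive_p)) _).
  refine (etrans (derive_sumE (fun k => diff_derivable (dyp k))) _).
  rewrite -big_split /=; apply: eq_bigr => k _.
  refine (etrans (derive_mulE (diff_derivable (diffdp (ddxdot R k) Oz))
    (diff_derivable (diffy k z))) _).
  exact: (congr2 +%R (mulrC _ _)
    (etrans (congr1 ( *%R _) (derive_fibre_coord k z (S c z))) (mulrC _ _))).
have F : \sum_j z.2 0 j * (\sum_k G k j z * 'D_(ddxdot R k) p z) =
    - \sum_k force S c k z * 'D_(ddxdot R k) p z.
  under eq_bigr do rewrite mulr_sumr.
  rewrite exchange_big /= -sumrN; apply: eq_bigr => k _.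
  rewrite -mulNr -Gamma_vertical // mulr_suml; apply: eq_bigr => j _.
  by rewrite mulrA (mulrC (z.2 0 j)).
rewrite /proj_a; have -> : \sum_j z.2 0 j * proj_b_comp z j =
    2 * (\sum_k z.2 0 k * 'D_(ddx R k) p z)
    - \sum_j z.2 0 j * (\sum_k G k j z * 'D_(ddxdot R k) p z)
    - p z * (\sum_k 'D_(ddxdot R k) p z * z.2 0 k)
    - \sum_k z.2 0 k * 'D_(S c z) ('D_(ddxdot R k) p) z.
  exact: weighted_sum_four.
rewrite F.
have := sum_derive_p Oz; have := S_of_P_coords Oz.
rewrite /fibre_coord E.
generalize (\sum_k force S c k z * 'D_(ddxdot R k) p z)
  (\sum_k z.2 0 k * 'D_(S c z) ('D_(ddxdot R k) p) z)
  (\sum_k z.2 0 k * 'D_(ddx R k) p z) => A B C BC.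
generalize (\sum_k 'D_(ddxdot R k) p z * z.2 0 k) => t ->.
lra.
Qed.

End ProjectiveChange.

(** * Matrix form and the conclusion at a point *)

Section Jacobi.
Variables (R : realType) (n : nat) (M : manifold R n) (c : chart_idx M).
Variables (S : vfield M) (P : tangent M -> R).
Hypotheses (hS : is_spray S) (smoothP : smooth_function P).
Hypothesis homP : pos_homogeneous P.

Definition proj_b_col z : 'cV[R]_n := \col_j proj_b_comp c S P z j.

Lemma proj_b_colE z (X : 'rV[R]_n) : slit_coords c z ->
  proj_b S P c z X = (X *m proj_b_col z) 0 0.
Proof.
by move=> Oz; rewrite proj_bE // mxE; apply: eq_bigr => j _; rewrite mxE.
Qed.

Lemma proj_b_col_T z : slit_coords c z ->
  z.2 *m proj_b_col z = - (proj_a S P c z)%:M.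
Proof.
move=> Oz; rewrite [LHS]mx11_scalar -raddfN; congr _%:M.
by rewrite -proj_b_T // mxE; apply: eq_bigr => j _; rewrite mxE.
Qed.

Lemma jacobi_T z : slit_coords c z -> z.2 *m jacobi S c z = 0.
Proof.
move=> Oz; apply/rowP => i; rewrite !mxE -[RHS](jacobi_annihilates_T hS i Oz).
by apply: eq_bigr => j _; rewrite mxE.
Qed.

Lemma jacobi_projective_change z : slit_coords c z ->
  jacobi (projective_change S P) c z =
  jacobi S c z + (proj_a S P c z)%:M + proj_b_col z *m z.2.
Proof.
move=> Oz; apply/matrixP => j i.
rewrite !mxE big_ord1 !mxE jacobi_comp_projective_change //.
by rewrite (eq_sym i j) mulr_natr.
Qed.
End Jacobi.
Theorem lemma4 (R : realType) (n : nat) (M : manifold R n)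
    (S : vfield M) (hS : is_spray S)
    (P : tangent M -> R) (smoothP : smooth_function P)
    (homP : pos_homogeneous P)
    (U : set (tangent M)) (slitU : U `<=` slit M)
    (lambda : 'I_n.-1 -> tangent M -> R)
    (diagPhi : forall v c, U v -> dom c (foot v) ->
       diagonalizable (jacobi S c (coords c v)))
    (specPhi : forall v c, U v -> dom c (foot v) ->
       char_poly (jacobi S c (coords c v)) =
       'X * \prod_(j < n.-1) ('X - (lambda j v)%:P)) :
  forall v c, U v -> dom c (foot v) ->
  let z := coords c v in
  let S' := projective_change S P in
  let a := proj_a S P c z in
  let b := proj_b S P c z in
  let cond1 := forall j, a <> - lambda j v in
  let cond2 := exists j, a = - lambda j v /\
     (forall X, eigendist S c z (lambda j v) X -> b X = 0) in
  (diagonalizable (jacobi S' c z) <-> cond1 \/ cond2) /\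
  (cond1 \/ cond2 ->
     (forall j, eigenvalue (jacobi S' c z) (lambda j v + a)) /\
     (forall l X, eigendist S c z l X ->
        eigendist S' c z (l + a) ((l + a) *: X + b X *: Tfield z))).
Proof.
move=> v c Uv cv z S' a b cond1 cond2.
have Oz : slit_coords c z := slit_coordsP (slitU _ Uv) cv.
have TA := jacobi_T hS Oz.
have Tb := proj_b_col_T hS smoothP homP Oz.
have bE X : b X = (X *m proj_b_col c S P z) 0 0 := proj_b_colE hS smoothP X Oz.
(* [z.2] is T at this point, nonzero because [U] avoids the zero section. *)
have z0 : z.2 != 0 by case: Oz.
rewrite /S' (jacobi_projective_change hS smoothP homP Oz) -/a.
split.
  rewrite (shift_diagonalizable_iff (diagPhi v c Uv cv) z0 TA Tb
    (specPhi v c Uv cv)) /cond1 /cond2.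
  split=> -[h|[j [aj bj]]]; [by left|right|by left|right];
    by exists j; split=> // X XA; move: (bj X XA); rewrite bE.
move=> _; split=> [j|l X XA].
  exact: (shift_eigenvalue (diagPhi v c Uv cv) z0 TA Tb (specPhi v c Uv cv)).
rewrite /eigendist /= (jacobi_projective_change hS smoothP homP Oz) bE.
exact: shift_eigenvector.
Qed.
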